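(* Let $A,P\in\mathbb{R}^{n\times n}$ be invertible and $b\in\mathbb{R}^n$. Consider NGMRESr($m$) used to accelerate the preconditioned Richardson iteration $q(x)=x+P(b-Ax)$, and left-preconditioned GMRES with left preconditioner $P$, for solving $g(x)=Ax-b=0$. Let $\{x_k^{NG(m)}\}$ be the iterates of NGMRESr($m$), $\{x_k^{Gl}\}$ the iterates of left-preconditioned GMRES, and $r_k^{Gl}=P(Ax_k^{Gl}-b)$. Assume that both methods use the same initial guess $x_0$, and that for some $k^*\in\mathbb{Z}^+$, $r^{Gl}_{k^*-1}\neq0$ and $\|r^{Gl}_k\|<\|r^{Gl}_{k-1}\|$ for all $k\in\mathbb{Z}^+$ with $0<k<k^*$. If $(PA)^T=PA$, or $PA=\tau I+S$ with $\tau\in\mathbb{R}$ and $S^T=-S$, then $x_k^{NG(m)}=x_k^{Gl}$ for all $m\in\mathbb{Z}^+$ and all $0\le k\le k^*$.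
   Context: $\|\cdot\|$ is the Euclidean 2-norm, $\mathbb{Z}^+$ is the set of positive integers, and $r(x)=x-q(x)=P(Ax-b)$. NGMRESr($m$): given $x_0\in\mathbb{R}^n$, for $k=0,1,2,\dots$ let $m_k=\min\{k,m\}$ and set $$x_{k+1}=q(x_k)+\sum_{i=0}^{m_k}\beta_i^{(k)}\big(q(x_k)-x_{k-i}\big),$$ where $\boldsymbol{\beta}^{(k)}=(\beta_0^{(k)},\dots,\beta_{m_k}^{(k)})\in\mathbb{R}^{m_k+1}$ is a minimizer of $$\Big\|r(q(x_k))+\sum_{i=0}^{m_k}\beta_i^{(k)}\big(r(q(x_k))-r(x_{k-i})\big)\Big\|^2 .$$ Left-preconditioned GMRES with preconditioner $P$ and initial guess $x_0$: let $r_0=P(Ax_0-b)$ and $\mathcal{K}_k(PA,r_0)=\mathrm{span}\{r_0,PAr_0,\dots,(PA)^{k-1}r_0\}$. Then $x_0^{Gl}=x_0$ and, for $k\ge1$, $x_k^{Gl}=x_0+z_k$, where $z_k\in\mathcal{K}_k(PA,r_0)$ minimizes $\|r_0+PAz\|$ over $z\in\mathcal{K}_k(PA,r_0)$. *)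

(* Defs.v *)
From mathcomp Require Import all_boot all_order all_algebra.
From mathcomp Require Import reals.
Set Implicit Arguments.
Unset Strict Implicit.
Unset Printing Implicit Defensive.
Import Order.TTheory GRing.Theory Num.Theory.
Local Open Scope ring_scope.

(* The norm MathComp-Analysis puts on matrices is the max norm. *)
Definition norm2 (R : realType) (n : nat) (v : 'cV[R]_n) : R :=
  Num.sqrt (\sum_(i < n) v i 0 ^+ 2).

Definition is_minimizer (R : realType) (T : Type)
    (D : T -> Prop) (f : T -> R) (t : T) : Prop :=
  D t /\ forall s : T, D s -> f t <= f s.

Definition richardson (R : realType) (n : nat) (A P : 'M[R]_n) (b x : 'cV[R]_n) :
    'cV[R]_n :=
  x + P *m (b - A *m x).

Definition pres (R : realType) (n : nat) (A P : 'M[R]_n) (b x : 'cV[R]_n) :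
    'cV[R]_n :=
  P *m (A *m x - b).

Lemma presE (R : realType) (n : nat) (A P : 'M[R]_n) (b x : 'cV[R]_n) :
  x - richardson A P b x = pres A P b x.
Proof. by rewrite /richardson /pres opprD addNKr -mulmxN opprB. Qed.

(* [is_ngmresr] and [is_gmres] are relations because least-squares minimizers
   need not be unique: every choice made at each step is allowed.  In the
   window sums i <= minn k m <= k, so the subtraction k - i is exact. *)
Definition is_ngmresr (R : realType) (n : nat) (A P : 'M[R]_n) (b : 'cV[R]_n)
    (m : nat) (x0 : 'cV[R]_n) (x : nat -> 'cV[R]_n) : Prop :=
  let q := richardson A P b in
  let r := pres A P b in
  x 0%N = x0 /\
  forall k : nat, exists beta : 'I_(minn k m).+1 -> R,
    is_minimizer (fun=> True)
      (fun c : 'I_(minn k m).+1 -> R =>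
         norm2 (r (q (x k)) +
                \sum_(i < (minn k m).+1)
                   c i *: (r (q (x k)) - r (x (k - i)%N))) ^+ 2)
      beta /\
    x k.+1 = q (x k) +
             \sum_(i < (minn k m).+1) beta i *: (q (x k) - x (k - i)%N).

Definition krylov (R : realType) (n : nat) (M : 'M[R]_n) (v : 'cV[R]_n) (k : nat) :
    {vspace 'cV[R]_n} :=
  <<[seq M ^+ i *m v | i <- iota 0 k]>>%VS.

Definition is_gmres (R : realType) (n : nat) (A P : 'M[R]_n) (b : 'cV[R]_n)
    (x0 : 'cV[R]_n) (x : nat -> 'cV[R]_n) : Prop :=
  let r0 := pres A P b x0 in
  x 0%N = x0 /\
  forall k : nat, (0 < k)%N -> exists z : 'cV[R]_n,
    is_minimizer (fun y => y \in krylov (P *m A) r0 k)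
      (fun y => norm2 (r0 + P *m A *m y)) z /\
    x k = x0 + z.

(* Main.v *)
Require Import Defs.
From mathcomp Require Import all_boot all_order all_algebra.
From mathcomp Require Import reals.
From mathcomp Require Import ring.
Set Implicit Arguments.
Unset Strict Implicit.
Unset Printing Implicit Defensive.
Import Order.TTheory GRing.Theory Num.Theory.
Local Open Scope ring_scope.

(** Write [M] for [P *m A], [x_k] for the GMRES iterates, [r_k] for their
    residuals and [K_k] for the Krylov spaces [krylov M r_0 k].  One step of
    NGMRESr minimizes the residual over the affine hull of [q x_k] and the
    window [x_k, x_(k-1), ...], that is, over [x_k] plus the span of [r_k] and
    of the differences of the [x_(k-i)].  If the earlier iterates agree with
    those of GMRES, this affine space is contained in [x_0 + K_(k+1)], where
    GMRES minimizes the same residual and has a unique solution because [M] is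
    injective.  So the two methods agree at step [k+1] as soon as the GMRES
    iterate lies in the smaller space.  Since every window with [k > 0] and
    [m > 0] contains [x_k] and [x_(k-1)], the point is the three-term
    recurrence
      [x_(k+1) = x_k + a (x_k - x_(k-1)) + c r_k].

    Let [d_k = x_(k+1) - x_k].  Least-squares optimality says that [r_k] is
    orthogonal to [M K_k]; hence [M d_k = r_(k+1) - r_k] is orthogonal to
    [M K_k] as well.  If GMRES did not stagnate at step [k], then
    [d_(k-1) <> 0], so [d_(k-1)] is not in [K_(k-1)], and
    [K_(k+1) = K_(k-1) + <d_(k-1)> + <r_k>] (lemma [krylov_split]).  Therefore
    [d_k = v + a d_(k-1) + c r_k] with [v] in [K_(k-1)].  Both hypotheses on [M]
    say that its transpose is [s I + t M], so [M^T M v] lies in [M K_k] and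
    [M r_k] is orthogonal to [M v].  The vectors [M d_k] and [M d_(k-1)] are
    orthogonal to [M v] too, so [M v] is orthogonal to itself and [v = 0]
    (lemma [gmres_three_term]). *)

(** * The Euclidean inner product *)

Definition dot (R : realType) (n : nat) (u v : 'cV[R]_n) : R :=
  (u^T *m v) 0 0.

Lemma dotDl (R : realType) (n : nat) (u v w : 'cV[R]_n) :
  dot (u + v) w = dot u w + dot v w.
Proof. by rewrite /dot linearD mulmxDl mxE. Qed.

Lemma dotZl (R : realType) (n : nat) (a : R) (u v : 'cV[R]_n) :
  dot (a *: u) v = a * dot u v.
Proof. by rewrite /dot linearZ -scalemxAl mxE. Qed.

Lemma dotC (R : realType) (n : nat) (u v : 'cV[R]_n) : dot u v = dot v u.
Proof. by rewrite /dot -[u^T *m v]trmxK mxE trmx_mul trmxK. Qed.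

Lemma dotDr (R : realType) (n : nat) (u v w : 'cV[R]_n) :
  dot u (v + w) = dot u v + dot u w.
Proof. by rewrite !(dotC u) dotDl. Qed.

Lemma dotZr (R : realType) (n : nat) (a : R) (u v : 'cV[R]_n) :
  dot u (a *: v) = a * dot u v.
Proof. by rewrite !(dotC u) dotZl. Qed.

Lemma dotBl (R : realType) (n : nat) (u v w : 'cV[R]_n) :
  dot (u - v) w = dot u w - dot v w.
Proof. by rewrite -scaleN1r dotDl dotZl mulN1r. Qed.

Lemma dot_mulmxl (R : realType) (n : nat) (M : 'M[R]_n) (u v : 'cV[R]_n) :
  dot (M *m u) v = dot u (M^T *m v).
Proof. by rewrite /dot trmx_mul mulmxA. Qed.

Lemma dot_sumsq (R : realType) (n : nat) (v : 'cV[R]_n) :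
  dot v v = \sum_(i < n) v i 0 ^+ 2.
Proof. by rewrite /dot mxE; apply: eq_bigr => i _; rewrite mxE expr2. Qed.

Lemma dot_ge0 (R : realType) (n : nat) (v : 'cV[R]_n) : 0 <= dot v v.
Proof. by rewrite dot_sumsq sumr_ge0 // => i _; rewrite sqr_ge0. Qed.

Lemma dot_eq0 (R : realType) (n : nat) (v : 'cV[R]_n) : dot v v = 0 -> v = 0.
Proof.
rewrite dot_sumsq => /eqP; rewrite psumr_eq0; last by move=> i _; exact: sqr_ge0.
move=> /allP h; apply/colP => i; rewrite mxE; apply/eqP.
by rewrite -sqrf_eq0; apply: h; rewrite mem_index_enum.
Qed.

Lemma norm2_le (R : realType) (n : nat) (u v : 'cV[R]_n) :
  (norm2 u <= norm2 v) = (dot u u <= dot v v).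
Proof. by rewrite /norm2 -!dot_sumsq ler_sqrt // dot_ge0. Qed.

Lemma norm2_ge0 (R : realType) (n : nat) (v : 'cV[R]_n) : 0 <= norm2 v.
Proof. exact: sqrtr_ge0. Qed.

(** * Linear least squares over a subspace *)

(** The normal equations: moving from [z] along [t *: v] changes the squared
    residual by [2 t p + t^2 s], with [p] the inner product below and [s] the
    square of [M *m v]; this can stay nonnegative for all [t] only if
    [p = 0]. *)
Lemma least_squares_orthogonal (R : realType) (n : nat) (M : 'M[R]_n)
    (U : {vspace 'cV[R]_n}) (r z v : 'cV[R]_n) :
  is_minimizer (fun y => y \in U) (fun y => norm2 (r + M *m y)) z ->
  v \in U -> dot (r + M *m z) (M *m v) = 0.
Proof.
case=> zU zmin vU.
have [-> | Mv_neq0] := eqVneq (M *m v) 0; first by rewrite /dot mulmx0 mxE.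
set p := dot _ _; set s := dot (M *m v) (M *m v).
have s_gt0 : 0 < s.
  by rewrite lt_neqAle dot_ge0 andbT eq_sym; apply: contra_neq Mv_neq0 => /dot_eq0.
(* [- p / s] is the step at which the quadratic in [t] is smallest. *)
have := zmin (z + (- (p / s)) *: v) (rpredD zU (rpredZ _ vU)).
rewrite norm2_le mulmxDr -scalemxAr addrA {zmin}.
move: (r + M *m z) @p => w p.
rewrite !dotDl !dotDr !dotZl !dotZr (dotC (M *m v) w) -/p -/s.
have -> : dot w w + - (p / s) * p + (- (p / s) * p + - (p / s) * (- (p / s) * s))
        = dot w w - p ^+ 2 / s by field; rewrite gt_eqF.
rewrite lerBrDr gerDl => h.
have : p ^+ 2 <= 0 by rewrite -(pmulr_lle0 _ (_ : 0 < s^-1)) ?invr_gt0.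
by move=> h2; apply/eqP; rewrite -sqrf_eq0 eq_le h2 sqr_ge0.
Qed.

(** By Pythagoras, a residual orthogonal to [M U] strictly grows under every
    nonzero correction from [U]. *)
Lemma least_squares_unique (R : realType) (n : nat) (M : 'M[R]_n)
    (r w : 'cV[R]_n) :
  M \in unitmx -> dot r (M *m w) = 0 -> norm2 (r + M *m w) <= norm2 r -> w = 0.
Proof.
move=> Mu h; rewrite norm2_le !dotDl !dotDr (dotC (M *m w) r) h addr0 add0r.
rewrite gerDl => h2.
have /dot_eq0 Mw0 : dot (M *m w) (M *m w) = 0.
  by apply/eqP; rewrite eq_le h2 dot_ge0.
by rewrite -(mulKmx Mu w) Mw0 mulmx0.
Qed.

(** * Krylov spaces *)

Lemma krylovS (R : realType) (n : nat) (M : 'M[R]_n) (v : 'cV[R]_n) (k : nat) :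
  krylov M v k.+1 = (krylov M v k + <[M ^+ k *m v]>)%VS.
Proof. by rewrite /krylov -(addn1 k) iotaD map_cat span_cat /= span_seq1 add0n. Qed.

Lemma krylov0 (R : realType) (n : nat) (M : 'M[R]_n) (v u : 'cV[R]_n) :
  u \in krylov M v 0 -> u = 0.
Proof. by rewrite /krylov /= span_nil memv0 => /eqP. Qed.

Lemma krylov_subS (R : realType) (n : nat) (M : 'M[R]_n) (v u : 'cV[R]_n) k :
  u \in krylov M v k -> u \in krylov M v k.+1.
Proof. by rewrite krylovS; apply/subvP/addvSl. Qed.

Lemma krylov_sub (R : realType) (n : nat) (M : 'M[R]_n) (v u : 'cV[R]_n) j k :
  (j <= k)%N -> u \in krylov M v j -> u \in krylov M v k.
Proof.
by move=> /subnK <- uK; elim: (k - j)%N => // i; rewrite addSn; apply: krylov_subS.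
Qed.

Lemma krylov_gen (R : realType) (n : nat) (M : 'M[R]_n) (v : 'cV[R]_n) k :
  M ^+ k *m v \in krylov M v k.+1.
Proof. by rewrite krylovS; apply: (subvP (addvSr _ _)); apply: memv_line. Qed.

Lemma krylovSP (R : realType) (n : nat) (M : 'M[R]_n) (v u : 'cV[R]_n) k :
  u \in krylov M v k.+1 ->
  exists w c, w \in krylov M v k /\ u = w + c *: (M ^+ k *m v).
Proof.
rewrite krylovS => /memv_addP[w wK [_ /vlineP[c ->] ->]].
by exists w, c.
Qed.

Lemma mulmx_krylov_gen (R : realType) (n : nat) (M : 'M[R]_n) (v : 'cV[R]_n) k :
  M *m (M ^+ k *m v) = M ^+ k.+1 *m v.
Proof. by rewrite mulmxA exprS. Qed.

Lemma mulmx_krylov (R : realType) (n : nat) (M : 'M[R]_n) (v u : 'cV[R]_n) k :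
  u \in krylov M v k -> M *m u \in krylov M v k.+1.
Proof.
elim: k u => [|k IH] u; first by move/krylov0 ->; rewrite mulmx0 mem0v.
case/krylovSP=> w [c [wK ->]]; rewrite mulmxDr -scalemxAr mulmx_krylov_gen.
by rewrite rpredD ?rpredZ ?krylov_gen // krylov_subS // IH.
Qed.

Lemma krylov_start (R : realType) (n : nat) (M : 'M[R]_n) (v : 'cV[R]_n) k :
  v \in krylov M v k.+1.
Proof.
by apply: (@krylov_sub _ _ _ _ _ 1) => //; have := krylov_gen M v 0;
  rewrite expr0 mul1mx.
Qed.

(** The last generator [M ^+ k.+1 *m v] of [krylov M v k.+2] can be traded for
    [r + M *m d]: since [d] lies outside [krylov M v k], its component along
    [M ^+ k *m v] is nonzero, so multiplication by [M] yields a nonzero multiple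
    of [M ^+ k.+1 *m v] up to lower terms. *)
Lemma krylov_split (R : realType) (n : nat) (M : 'M[R]_n)
    (v d r u : 'cV[R]_n) (k : nat) :
  d \in krylov M v k.+1 -> d \notin krylov M v k -> r \in krylov M v k.+1 ->
  u \in krylov M v k.+2 ->
  exists w a c, w \in krylov M v k /\ u = w + a *: d + c *: (r + M *m d).
Proof.
move=> /krylovSP[w [a [wK dE]]] dNK rK /krylovSP[u1 [c [u1K ->]]].
have a_neq0 : a != 0.
  by apply: contraNneq dNK => a0; rewrite dE a0 scale0r addr0.
have genE : M ^+ k *m v = a^-1 *: (d - w).
  by rewrite dE addrC addKr scalerA mulVf // scale1r.
have reduce y : y \in krylov M v k.+1 ->
    exists w' a', w' \in krylov M v k /\ y = w' + a' *: d.
  case/krylovSP=> y1 [e [y1K ->]].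
  exists (y1 - (e / a) *: w), (e / a).
  by rewrite rpredB ?rpredZ // genE scalerA scalerBr addrA addrAC.
have [|w' [a' [w'K w'E]]] := reduce (u1 - (c / a) *: (r + M *m w)).
  by rewrite rpredB ?rpredZ ?rpredD // mulmx_krylov.
exists w', a', (c / a); split=> //; rewrite -w'E -mulmx_krylov_gen genE.
rewrite -scalemxAr mulmxBr.
move: (M *m d) (M *m w) => Md Mw.
by apply/colP => i; rewrite !mxE; field.
Qed.

Lemma memvB_trans (R : realType) (n : nat) (U : {vspace 'cV[R]_n})
    (x y z : 'cV[R]_n) : x - z \in U -> y - z \in U -> x - y \in U.
Proof. by move=> xU yU; rewrite -[x](subrK z) -addrA -[z - y]opprB rpredB. Qed.

(** * GMRES *)

Lemma presB (R : realType) (n : nat) (A P : 'M[R]_n) (b x y : 'cV[R]_n) :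
  pres A P b x - pres A P b y = P *m A *m (x - y).
Proof. by rewrite /pres -mulmxBr opprB addrA subrK -mulmxBr mulmxA. Qed.

Lemma pres_shift (R : realType) (n : nat) (A P : 'M[R]_n) (b x y : 'cV[R]_n) :
  pres A P b x = pres A P b y + P *m A *m (x - y).
Proof. by rewrite -(presB A P b) addrC subrK. Qed.

Lemma gmres_step_krylov (R : realType) (n : nat) (A P : 'M[R]_n)
    (b x0 : 'cV[R]_n) (x : nat -> 'cV[R]_n) (k : nat) :
  is_gmres A P b x0 x -> x k - x0 \in krylov (P *m A) (pres A P b x0) k.
Proof.
case=> xI xS; case: k => [|k]; first by rewrite xI subrr mem0v.
by have [//|z [[zK _] ->]] := xS k.+1; rewrite addrC addKr.
Qed.

Lemma gmres_orthogonal (R : realType) (n : nat) (A P : 'M[R]_n)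
    (b x0 : 'cV[R]_n) (x : nat -> 'cV[R]_n) (j k : nat) (v : 'cV[R]_n) :
  is_gmres A P b x0 x -> (j <= k)%N ->
  v \in krylov (P *m A) (pres A P b x0) j ->
  dot (pres A P b (x k)) (P *m A *m v) = 0.
Proof.
move=> [_ xS] jk /(krylov_sub jk).
case: k {jk} => [/krylov0 ->|k vK]; first by rewrite /dot !mulmx0 mxE.
have [//|z [zmin ->]] := xS k.+1.
by rewrite (pres_shift _ _ _ _ x0) addrAC subrr add0r
  (least_squares_orthogonal zmin vK).
Qed.

Lemma gmres_diff_krylov (R : realType) (n : nat) (A P : 'M[R]_n)
    (b x0 : 'cV[R]_n) (x : nat -> 'cV[R]_n) (k : nat) :
  is_gmres A P b x0 x ->
  x k.+1 - x k \in krylov (P *m A) (pres A P b x0) k.+1.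
Proof.
move=> hx; apply: (memvB_trans (z := x0)); first exact: gmres_step_krylov.
by apply: krylov_subS; apply: gmres_step_krylov.
Qed.

Lemma gmres_res_krylov (R : realType) (n : nat) (A P : 'M[R]_n)
    (b x0 : 'cV[R]_n) (x : nat -> 'cV[R]_n) (k : nat) :
  is_gmres A P b x0 x ->
  pres A P b (x k) \in krylov (P *m A) (pres A P b x0) k.+1.
Proof.
move=> hx; rewrite (pres_shift _ _ _ _ x0).
by rewrite rpredD ?krylov_start // mulmx_krylov // gmres_step_krylov.
Qed.

Lemma gmres_diff_orthogonal (R : realType) (n : nat) (A P : 'M[R]_n)
    (b x0 : 'cV[R]_n) (x : nat -> 'cV[R]_n) (k : nat) (v : 'cV[R]_n) :
  is_gmres A P b x0 x -> v \in krylov (P *m A) (pres A P b x0) k ->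
  dot (P *m A *m (x k.+1 - x k)) (P *m A *m v) = 0.
Proof.
move=> hx vK; rewrite -(presB A P b) dotBl.
by rewrite !(gmres_orthogonal hx _ vK) ?subrr.
Qed.

(** The correction [d] of the previous step is new whenever it is nonzero,
    because [M *m d] is orthogonal to the image of the old Krylov space. *)
Lemma gmres_diff_new (R : realType) (n : nat) (A P : 'M[R]_n)
    (b x0 : 'cV[R]_n) (x : nat -> 'cV[R]_n) (k : nat) :
  P *m A \in unitmx -> is_gmres A P b x0 x -> x k.+1 <> x k ->
  x k.+1 - x k \notin krylov (P *m A) (pres A P b x0) k.
Proof.
move=> Mu hx xne; apply/negP => dK; apply: xne.
have /dot_eq0 Md0 := gmres_diff_orthogonal hx dK.
by apply/eqP; rewrite -subr_eq0 -(mulKmx Mu (x k.+1 - x k)) Md0 mulmx0.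
Qed.

(** The argument of conjugate-residual methods: the transpose of [M = P *m A]
    being a polynomial of degree at most one in [M], every term of the split
    new correction other than [v], the part in [krylov _ _ k], has an image
    under [M] orthogonal to [M *m v]; so has the correction itself, which leaves
    [M *m v] orthogonal to itself. *)
Lemma gmres_three_term (R : realType) (n : nat) (A P : 'M[R]_n)
    (b x0 : 'cV[R]_n) (x : nat -> 'cV[R]_n) (k : nat) (s t : R) :
  P *m A \in unitmx -> (P *m A)^T = s%:M + t *: (P *m A) ->
  is_gmres A P b x0 x -> x k.+1 <> x k ->
  exists a c,
    x k.+2 - x k.+1 = a *: (x k.+1 - x k) + c *: pres A P b (x k.+1).
Proof.
move=> Mu MT hx xne.
have [v [a [c [vK]]]] := krylov_split (gmres_diff_krylov k hx)
  (gmres_diff_new Mu hx xne) (gmres_res_krylov k hx) (gmres_diff_krylov k.+1 hx).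
rewrite -pres_shift => dE.
have vKS := krylov_subS vK.
suff v0 : v = 0 by exists a, c; rewrite dE v0 add0r.
have Md_orth : dot (P *m A *m (x k.+2 - x k.+1)) (P *m A *m v) = 0.
  exact: gmres_diff_orthogonal hx vKS.
have Mr_orth : dot (P *m A *m pres A P b (x k.+1)) (P *m A *m v) = 0.
  rewrite dot_mulmxl MT mulmxDl mul_scalar_mx -scalemxAl dotDr !dotZr.
  rewrite (gmres_orthogonal hx (leqnn _) vKS).
  by rewrite (gmres_orthogonal hx (leqnn _) (mulmx_krylov vK)) !mulr0 addr0.
move: Md_orth; rewrite dE !mulmxDr -!scalemxAr !dotDl !dotZl Mr_orth.
rewrite (gmres_diff_orthogonal hx vK) !mulr0 !addr0 => /dot_eq0 Mv0.
by rewrite -(mulKmx Mu v) Mv0 mulmx0.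
Qed.

Lemma gmres_first_step (R : realType) (n : nat) (A P : 'M[R]_n)
    (b x0 : 'cV[R]_n) (x : nat -> 'cV[R]_n) :
  is_gmres A P b x0 x -> exists c, x 1%N - x 0%N = c *: pres A P b (x 0%N).
Proof.
move=> hx; have [w [c [/krylov0 -> ->]]] := krylovSP (gmres_diff_krylov 0 hx).
by exists c; rewrite add0r expr0 mul1mx hx.1.
Qed.

(** * NGMRESr *)

Lemma pres_window (R : realType) (n : nat) (A P : 'M[R]_n) (b q : 'cV[R]_n)
    (w : nat) (c : 'I_w -> R) (y : 'I_w -> 'cV[R]_n) :
  pres A P b q + \sum_(i < w) c i *: (pres A P b q - pres A P b (y i)) =
  pres A P b (q + \sum_(i < w) c i *: (q - y i)).
Proof.
rewrite [RHS](pres_shift _ _ _ _ q) addrAC subrr add0r mulmx_sumr.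
by congr (_ + _); apply: eq_bigr => i _; rewrite presB scalemxAr.
Qed.

(** The weights express [x k + a (x k - x k.-1) + c r] as an affine combination
    of [q (x k) = x k - r], [x k] and [x k.-1]; the weight of [x k] is fixed by
    the requirement that all weights add up to one. *)
Lemma window_two_step (R : realType) (n : nat) (A P : 'M[R]_n) (b : 'cV[R]_n)
    (x : nat -> 'cV[R]_n) (w k : nat) (a c : R) :
  exists beta : 'I_w.+2 -> R,
    richardson A P b (x k) +
      \sum_(i < w.+2) beta i *: (richardson A P b (x k) - x (k - i)%N) =
    x k + a *: (x k - x k.-1) + c *: pres A P b (x k).
Proof.
exists (fun i => if i == 0 :> nat then - 1 - a - c
                 else if i == 1%N :> nat then a else 0).
rewrite !big_ord_recl big1 => [|i _]; last by rewrite /= scale0r.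
rewrite /= subn0 subn1 -(presE A P b); move: (richardson _ _ _ _) => q.
by apply/colP => i; rewrite !mxE; ring.
Qed.

Lemma window_one_step (R : realType) (n : nat) (A P : 'M[R]_n) (b : 'cV[R]_n)
    (y : 'cV[R]_n) (c : R) :
  richardson A P b y + (- 1 - c) *: (richardson A P b y - y) =
  y + c *: pres A P b y.
Proof.
rewrite -(presE A P b); move: (richardson _ _ _ _) => q.
by apply/colP => i; rewrite !mxE; ring.
Qed.

(** Optimality over the window makes the NGMRESr residual at most that of
    GMRES, whose least-squares problem over the larger affine space
    [x0 + krylov _ _ k.+1] has only one solution. *)
Lemma ngmresr_step_eq (R : realType) (n : nat) (A P : 'M[R]_n)
    (b x0 : 'cV[R]_n) (x y : nat -> 'cV[R]_n) (m k : nat)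
    (gam : 'I_(minn k m).+1 -> R) :
  P *m A \in unitmx -> is_gmres A P b x0 x -> is_ngmresr A P b m x0 y ->
  (forall j, (j <= k)%N -> y j = x j) ->
  richardson A P b (x k) +
    \sum_(i < (minn k m).+1) gam i *: (richardson A P b (x k) - x (k - i)%N) =
    x k.+1 ->
  y k.+1 = x k.+1.
Proof.
move=> Mu hx [_ hy] yx gamE.
have [beta [[_ /(_ gam I)]]] := hy k.
have res c : pres A P b (richardson A P b (y k)) +
    \sum_(i < (minn k m).+1) c i *: (pres A P b (richardson A P b (y k)) -
       pres A P b (y (k - i)%N)) =
    pres A P b (richardson A P b (x k) +
      \sum_(i < (minn k m).+1) c i *: (richardson A P b (x k) - x (k - i)%N)).
  rewrite pres_window yx //; congr (pres _ _ _ (_ + _)).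
  by apply: eq_bigr => i _; rewrite yx ?leq_subr.
rewrite !res gamE ler_sqr ?nnegrE ?norm2_ge0 // => minb yE.
have yE' : y k.+1 = richardson A P b (x k) +
    \sum_(i < (minn k m).+1) beta i *: (richardson A P b (x k) - x (k - i)%N).
  rewrite yE yx //; congr (_ + _).
  by apply: eq_bigr => i _; rewrite yx ?leq_subr.
move: minb; rewrite -yE' (pres_shift _ _ _ _ (x k.+1)) => minb.
set K := krylov (P *m A) (pres A P b x0) k.+1.
have xK j : (j <= k.+1)%N -> x j - x0 \in K.
  by move=> jk; apply: krylov_sub jk _; apply: gmres_step_krylov.
have qK : richardson A P b (x k) - x0 \in K.
  rewrite -[richardson _ _ _ _](subKr (x k)) presE addrAC rpredB ?xK //.
  exact: gmres_res_krylov.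
have yK : y k.+1 - x k.+1 \in K.
  apply: (memvB_trans (z := x0)); last exact: xK.
  rewrite yE' addrAC rpredD // rpred_sum // => i _; apply: rpredZ.
  apply: (memvB_trans qK); apply: xK.
  by rewrite (leq_trans (leq_subr _ _)).
apply/eqP; rewrite -subr_eq0; apply/eqP.
by apply: (least_squares_unique Mu _ minb); apply: gmres_orthogonal hx _ yK.
Qed.

Theorem theorem3p5 (R : realType) (n : nat) (A P : 'M[R]_n) (b x0 : 'cV[R]_n)
    (xGl : nat -> 'cV[R]_n) (kstar : nat)
    (hA : A \in unitmx) (hP : P \in unitmx)
    (hGl : is_gmres A P b x0 xGl)
    (hkstar : (0 < kstar)%N)
    (hres : pres A P b (xGl kstar.-1) <> 0)
    (hdecr : forall k : nat, (0 < k)%N -> (k < kstar)%N ->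
       norm2 (pres A P b (xGl k)) < norm2 (pres A P b (xGl k.-1)))
    (hPA : (P *m A)^T = P *m A \/
       exists (tau : R) (S : 'M[R]_n), P *m A = tau%:M + S /\ S^T = - S) :
  forall (m : nat) (xNG : nat -> 'cV[R]_n), (0 < m)%N ->
    is_ngmresr A P b m x0 xNG ->
    forall k : nat, (k <= kstar)%N -> xNG k = xGl k.
Proof.
move=> m xNG m_gt0 hNG k; have Mu : P *m A \in unitmx by rewrite unitmx_mul hP.
have [s [t MT]] : exists s t, (P *m A)^T = s%:M + t *: (P *m A).
  case: hPA => [-> | [tau [S [-> ST]]]].
    by exists 0, 1; rewrite scale1r raddf0 add0r.
  (* The transpose of [tau + S] is [tau - S = 2 tau - (tau + S)]. *)
  exists (tau *+ 2), (- 1); rewrite linearD /= tr_scalar_mx ST scaleN1r.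
  by rewrite raddfMn mulr2n opprD addrA addrK.
elim/ltn_ind: k => -[_ _|k IH kk]; first by rewrite hNG.1 hGl.1.
have yx j : (j <= k)%N -> xNG j = xGl j.
  by move=> jk; apply: IH => //; apply: leq_trans jk (ltnW kk).
case: k => [|k] in IH kk yx *.
  have [c cE] := gmres_first_step hGl.
  apply: (ngmresr_step_eq (gam := fun=> - 1 - c) Mu hGl hNG yx).
  move: (minn 0 m) (min0n m) => _ ->.
  by rewrite big_ord1 subn0 window_one_step -cE addrC subrK.
have xne : xGl k.+1 <> xGl k.
  by move=> e; have := hdecr k.+1 isT kk; rewrite /= e ltxx.
have [a [c acE]] := gmres_three_term Mu MT hGl xne.
suff [gam gamE] : exists gam : 'I_(minn k.+1 m).+1 -> R,
    richardson A P b (xGl k.+1) + \sum_(i < (minn k.+1 m).+1)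
      gam i *: (richardson A P b (xGl k.+1) - xGl (k.+1 - i)%N) = xGl k.+2.
  exact: ngmresr_step_eq Mu hGl hNG yx gamE.
case: m m_gt0 {hNG} => // m _; rewrite minnSS.
have [gam gamE] := window_two_step A P b xGl (minn k m) k.+1 a c.
by exists gam; rewrite gamE -addrA -acE addrC subrK.
Qed.
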